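(* Let $0<\nu\le\mu$. Let $A,B^\varepsilon\in\mathcal{M}_N(\mathbb{R})$ be symmetric matrices such that $A_\sharp$ and $B^\varepsilon_\sharp$ are non-positive, $B^\varepsilon\to B^0$ as $\varepsilon\to0$, and $\mathrm{Ker}(B^\varepsilon_\sharp)$ is constant for $\varepsilon\ge0$. Let $W\in\mathcal{M}_N(\mathbb{R})$, and let $\Pi$ be the orthogonal projection onto $\mathrm{Ker}\,A_\sharp\cap\mathrm{Ker}\,B^\varepsilon_\sharp$. Let $c>0$ be the constant $$c=\min_{\|x\|=1,\ \Pi x=0}-\big((A_\sharp+B^0_\sharp)x,x\big).$$ If $y$ is the solution, with given initial value $y(0)\in\mathbb{R}^N$, of $$\partial_t y=(\varepsilon^{-\mu}A+\varepsilon^{-\nu}B^\varepsilon+W)_\sharp\,y,$$ and if $z$ is the solution of $$\partial_t z=\Pi W_\sharp\Pi z,\qquad z(0)=\Pi y(0),$$ then, for $t\in[0,T]$, $$\|(1-\Pi)y(t)\|\le C\big(\varepsilon^\nu+\exp(-ct\varepsilon^{-\nu})\big),$$ $$\|\Pi(y-z)(t)\|\le C\big(\varepsilon^\nu+\exp(-ct\varepsilon^{-\nu})\big),$$ where $C$ depends on $W$, $y(0)$, $T$ and $c$ (and not on $\varepsilon$). In particular, $\lim_{\varepsilon\to0}(1-\Pi)y(t)=0$ for $t\in(0,T]$.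
   Context: $\mathcal{M}_N(\mathbb{R})$ is the space of real $N\times N$ matrices, and $\varepsilon\in(0,1]$ is a small parameter. For a matrix $A=(A(n,k))_{1\le n,k\le N}$, $A_\sharp$ denotes the matrix with entries $A_\sharp(n,k)=A(k,n)$ if $n\ne k$ and $A_\sharp(n,n)=-\sum_{m\ne n}A(n,m)$. A symmetric real matrix $M$ is non-positive if $(Mx,x)\le0$ for all $x\in\mathbb{R}^N$, where $(\cdot,\cdot)$ and $\|\cdot\|$ are the Euclidean inner product and norm. $T>0$ is a fixed time.
   Formalization: The printed bounds can fail; proved: both with c at each ε where the minimum with B^ε in place of B^0 is ≥ c; in general, for every c'<c, the first with c' in the exponential and the second as printed, with C depending also on c' and ε ≤ ε_0 (depending on the family); the limit is unchanged. *)

(* Defs.v *)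
From HB Require Import structures.
From mathcomp Require Import all_boot all_order all_algebra.
From mathcomp Require Import all_classical all_reals all_analysis.

Set Implicit Arguments.
Unset Strict Implicit.
Unset Printing Implicit Defensive.
Import Order.TTheory GRing.Theory Num.Theory numFieldNormedType.Exports.

Local Open Scope classical_set_scope.
Local Open Scope ring_scope.

Definition sharp (R : realType) (N : nat) (A : 'M[R]_N) : 'M[R]_N :=
  \matrix_(n, k) (if n == k then - \sum_(m | m != n) A n m else A k n).

(* The norm [`|_|] that the library puts on matrices is the sup norm, so the
   Euclidean structure on column vectors is introduced separately. *)
Definition dotp (R : realType) (N : nat) (x y : 'cV[R]_N) : R :=
  \sum_i x i 0 * y i 0.

Definition enorm (R : realType) (N : nat) (x : 'cV[R]_N) : R :=
  Num.sqrt (dotp x x).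

Definition nonpositive (R : realType) (N : nat) (M : 'M[R]_N) : Prop :=
  forall x : 'cV[R]_N, dotp (M *m x) x <= 0.

Definition in_ker (R : realType) (N : nat) (M : 'M[R]_N) (x : 'cV[R]_N) : Prop :=
  M *m x = 0.

Definition is_orth_proj (R : realType) (N : nat)
    (Pi : 'M[R]_N) (K : 'cV[R]_N -> Prop) : Prop :=
  forall x, K (Pi *m x) /\ (forall v, K v -> dotp (x - Pi *m x) v = 0).

Definition gap_ge (R : realType) (N : nat) (Pi S : 'M[R]_N) (c : R) : Prop :=
  forall x : 'cV[R]_N, enorm x = 1 -> Pi *m x = 0 -> c <= - dotp (S *m x) x.

(* [c] is the minimum of [- (S x, x)] over the unit vectors [x] with
   [Pi x = 0]; that the minimum exists (so that [Pi] is not the identity) is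
   part of the definition. *)
Definition is_gap (R : realType) (N : nat) (Pi S : 'M[R]_N) (c : R) : Prop :=
  (exists x, [/\ enorm x = 1, Pi *m x = 0 & - dotp (S *m x) x = c]) /\
  gap_ge Pi S c.

Definition solves (R : realType) (N : nat) (T : R) (M : 'M[R]_N)
    (y0 : 'cV[R]_N) (y : R -> 'cV[R]_N) : Prop :=
  [/\ y 0 = y0,
      {within `[0, T], continuous y} &
      forall t, 0 < t < T -> is_derive t (1 : R) y (M *m y t)].

Definition generator (R : realType) (N : nat) (nu mu eps : R)
    (A B W : 'M[R]_N) : 'M[R]_N :=
  sharp (eps `^ (- mu) *: A + eps `^ (- nu) *: B + W).

(* [B eps] is the matrix B^eps for 0 <= eps <= 1; in particular [B 0] is the
   limit B^0.  [y eps] is the solution for the parameter [eps]; the limit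
   system, hence [z], does not involve [eps]. *)
Record relaxation (R : realType) (N : nat) (W : 'M[R]_N) (y0 : 'cV[R]_N)
    (T c nu mu : R) (A : 'M[R]_N) (B : R -> 'M[R]_N) (Pi : 'M[R]_N)
    (y : R -> R -> 'cV[R]_N) (z : R -> 'cV[R]_N) : Prop := {
  rlx_exponents : 0 < nu <= mu;
  rlx_symA : A^T = A;
  rlx_symB : forall eps, 0 < eps <= 1 -> (B eps)^T = B eps;
  rlx_nposA : nonpositive (sharp A);
  rlx_nposB : forall eps, 0 < eps <= 1 -> nonpositive (sharp (B eps));
  rlx_cvgB : B eps @[eps --> 0^'+] --> B 0;
  rlx_kerB : forall eps, 0 <= eps <= 1 -> forall x,
    in_ker (sharp (B eps)) x <-> in_ker (sharp (B 0)) x;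
  rlx_proj : forall eps, 0 <= eps <= 1 ->
    is_orth_proj Pi (fun x => in_ker (sharp A) x /\ in_ker (sharp (B eps)) x);
  rlx_gap : is_gap Pi (sharp A + sharp (B 0)) c;
  rlx_y : forall eps, 0 < eps <= 1 ->
    solves T (generator nu mu eps A (B eps) W) y0 (y eps);
  rlx_z : solves T (Pi *m sharp W *m Pi) (Pi *m y0) z
}.

(* Main.v *)
Require Import Defs.
From HB Require Import structures.
From mathcomp Require Import all_boot all_order all_algebra.
From mathcomp Require Import all_classical all_reals all_analysis.
From mathcomp Require Import ring lra.

(** Write [V = sharp W] and [S] for the stiff part
    [eps^-mu sharp A + eps^-nu sharp (B eps)] of the generator.  Symmetry of [A]
    and [B eps] makes [S] symmetric, so that [Pi], the projection onto a subspace
    of [Ker S], satisfies [S Pi = Pi S = 0]; and since [eps^-mu >= eps^-nu], a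
    spectral gap [r] of [sharp A + sharp (B eps)] gives [(S x, x) <= - a |x|^2]
    on [Ker Pi] with [a = r eps^-nu].

    Let [K] bound [V].  As [S] is non-positive, [|y| <= M := exp (K T) |y0|] on
    [0, T], uniformly in [eps].  The fast part [v = (1 - Pi) y] obeys
    [|v|' <= - a |v| + K M], hence [|v t| <= exp (- a t) |y0| + K M / a], which is
    the first estimate.  The defect [w = Pi (y - z)] of the slow part vanishes at
    time 0 and obeys [|w|' <= K |w| + K |v|].  Integrating the bound on [v] is
    avoided by following [G = |w| + (K / a) |v|], for which the forcing [K |v|]
    cancels against the damping of [v]: [G' <= K G + K^2 M / a].  Since
    [G 0 <= K |y0| / a], this gives [|w| = O (1 / a) = O (eps^nu)], with no
    exponential term.  All of this is [fast_slow_bound]; the norms are smoothed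
    by a parameter [d], sent to 0 at the end, because they are not differentiable
    at the origin.

    When [eps] is small, [sharp (B eps)] is close to [sharp (B 0)] and every
    [r < c] is a gap ([relaxation_gap_near]).  With [r = c / 2], the inequality
    [exp (- u) <= 1 / u] shows that [v] tends to 0 at every positive time. *)

Set Implicit Arguments.
Unset Strict Implicit.
Unset Printing Implicit Defensive.
Import Order.TTheory GRing.Theory Num.Theory numFieldNormedType.Exports.

Local Open Scope classical_set_scope.
Local Open Scope ring_scope.

(** * Euclidean structure *)

Lemma dotpE (R : realType) (N : nat) (x y : 'cV[R]_N) :
  dotp x y = (x^T *m y) 0 0.
Proof. by rewrite /dotp mxE; apply: eq_bigr => i _; rewrite mxE. Qed.

Lemma dotpC (R : realType) (N : nat) (x y : 'cV[R]_N) : dotp x y = dotp y x.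
Proof. by rewrite /dotp; apply: eq_bigr => i _; rewrite mulrC. Qed.

Lemma dotpDl (R : realType) (N : nat) (x y z : 'cV[R]_N) :
  dotp (x + y) z = dotp x z + dotp y z.
Proof. by rewrite !dotpE linearD mulmxDl mxE. Qed.

Lemma dotpZl (R : realType) (N : nat) (k : R) (x y : 'cV[R]_N) :
  dotp (k *: x) y = k * dotp x y.
Proof. by rewrite !dotpE linearZ -scalemxAl mxE. Qed.

Lemma dotpNl (R : realType) (N : nat) (x y : 'cV[R]_N) :
  dotp (- x) y = - dotp x y.
Proof. by rewrite -scaleN1r dotpZl mulN1r. Qed.

Lemma dotpDr (R : realType) (N : nat) (x y z : 'cV[R]_N) :
  dotp x (y + z) = dotp x y + dotp x z.
Proof. by rewrite dotpC dotpDl !(dotpC x). Qed.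

Lemma dotpZr (R : realType) (N : nat) (k : R) (x y : 'cV[R]_N) :
  dotp x (k *: y) = k * dotp x y.
Proof. by rewrite dotpC dotpZl dotpC. Qed.

Lemma dotpNr (R : realType) (N : nat) (x y : 'cV[R]_N) :
  dotp x (- y) = - dotp x y.
Proof. by rewrite dotpC dotpNl dotpC. Qed.

Lemma dotp0r (R : realType) (N : nat) (x : 'cV[R]_N) : dotp x 0 = 0.
Proof. by rewrite dotpE mulmx0 mxE. Qed.

Lemma dotp_mulmx (R : realType) (N : nat) (A : 'M[R]_N) (x y : 'cV[R]_N) :
  dotp (A *m x) y = dotp x (A^T *m y).
Proof. by rewrite !dotpE trmx_mul mulmxA. Qed.

Lemma dotp_ge0 (R : realType) (N : nat) (x : 'cV[R]_N) : 0 <= dotp x x.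
Proof. by apply: sumr_ge0 => i _; rewrite -expr2 sqr_ge0. Qed.

Lemma dotp_eq0 (R : realType) (N : nat) (x : 'cV[R]_N) :
  dotp x x = 0 -> x = 0.
Proof.
move=> /eqP; rewrite psumr_eq0 => [/allP x0|i _]; last by rewrite -expr2 sqr_ge0.
apply/colP => i; have := x0 i (mem_index_enum i).
by rewrite -expr2 sqrf_eq0 => /eqP ->; rewrite mxE.
Qed.

Lemma enorm_ge0 (R : realType) (N : nat) (x : 'cV[R]_N) : 0 <= enorm x.
Proof. exact: sqrtr_ge0. Qed.

Lemma enorm_sqr (R : realType) (N : nat) (x : 'cV[R]_N) :
  enorm x ^+ 2 = dotp x x.
Proof. by rewrite sqr_sqrtr// dotp_ge0. Qed.

Lemma enorm_gt0 (R : realType) (N : nat) (x : 'cV[R]_N) :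
  x != 0 -> 0 < enorm x.
Proof.
move=> x0; rewrite sqrtr_gt0 lt_neqAle dotp_ge0 andbT eq_sym.
by apply: contra x0 => /eqP/dotp_eq0 ->.
Qed.

Lemma enormZ (R : realType) (N : nat) (k : R) (x : 'cV[R]_N) :
  0 <= k -> enorm (k *: x) = k * enorm x.
Proof.
move=> k0; rewrite /enorm dotpZl dotpZr mulrA -expr2 sqrtrM ?sqr_ge0//.
by rewrite sqrtr_sqr ger0_norm.
Qed.

Lemma coord_le_enorm (R : realType) (N : nat) (x : 'cV[R]_N) i :
  `|x i 0| <= enorm x.
Proof.
rewrite -sqrtr_sqr ler_sqrt ?dotp_ge0// /dotp (bigD1 i)//= -expr2 lerDl.
by apply: sumr_ge0 => j _; rewrite -expr2 sqr_ge0.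
Qed.

(** The sum of the moduli of the entries: a crude bound for the Euclidean
    operator norm, preferred because it is visibly continuous in the matrix. *)
Definition entrysum (R : realType) (N : nat) (V : 'M[R]_N) : R :=
  \sum_i \sum_j `|V i j|.

Lemma entrysum_ge0 (R : realType) (N : nat) (V : 'M[R]_N) : 0 <= entrysum V.
Proof. by apply: sumr_ge0 => i _; apply: sumr_ge0. Qed.

Lemma dotp_mulmx_le (R : realType) (N : nat) (V : 'M[R]_N) (x y : 'cV[R]_N) :
  dotp (V *m x) y <= entrysum V * (enorm x * enorm y).
Proof.
rewrite /dotp /entrysum mulr_suml; apply: ler_sum => i _.
rewrite mxE !mulr_suml; apply: ler_sum => j _.
rewrite -mulrA (le_trans (ler_norm _))// normrM ler_wpM2l// normrM.
by rewrite ler_pM// coord_le_enorm.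
Qed.

(** * Differential inequalities *)

(** Growth of a scalar function with [g' <= k g + b]: the function
    [exp (- k t) (g + b / k)] is nonincreasing. *)
Lemma gronwall (R : realType) (T k b : R) (g g' : R -> R) : k != 0 ->
  {within `[0, T], continuous g} ->
  (forall t, 0 < t < T -> is_derive t (1 : R) g (g' t)) ->
  (forall t, 0 < t < T -> g' t <= k * g t + b) ->
  forall t, 0 <= t <= T -> g t <= expR (k * t) * (g 0 + b / k) - b / k.
Proof.
move=> k0 gC gD g'le t /andP[t0 tT].
pose h s := expR (- k * s) * (g s + b / k).
have eD s : is_derive s (1 : R) (fun s => expR (- k * s)) (expR (- k * s) * - k).
  have : is_derive s (1 : R) (fun s => - k * s) (- k).
    rewrite -[X in is_derive _ _ _ X]mulr1.
    exact: (is_deriveZ (- k) (is_derive_id s (1 : R))).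
  exact: is_derive1_comp.
have hD s : 0 < s < T -> is_derive s (1 : R) h
    (expR (- k * s) * g' s + (g s + b / k) * (expR (- k * s) * - k)).
  move=> sT; have gs := gD s sT; have es := eD s.
  have gs2 : is_derive s (1 : R) (fun s => g s + b / k) (g' s).
    by rewrite -[g' s]addr0; apply: is_deriveD.
  exact: is_deriveM.
have hC : {within `[0, T], continuous h}.
  move=> s; apply: (@continuousM _ (subspace `[0, T])
    (fun s => expR (- k * s)) (fun s => g s + b / k)).
    apply: (@continuous_subspaceT _ _ `[0, T] (fun s => expR (- k * s))) => r.
    by apply/differentiable_continuous/derivable1_diffP; have [] := eD r.
  by apply: continuousD; [exact: gC|exact: cst_continuous].
have : h t <= h 0.
  apply: (@ler0_derive1_nincr _ h 0 T) => // s; rewrite in_itv/= => sT.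
    by have [] := hD s sT.
  have hs := hD s sT; rewrite derive1E derive_val.
  rewrite mulrCA -mulrDr; apply: mulr_ge0_le0; first exact: expR_ge0.
  have := g'le s sT; rewrite mulrN mulrDl divfK// mulrC => ?; lra.
rewrite /h mulr0 expR0 mul1r => hle.
rewrite lerBrDr -ler_pdivrMl ?expR_gt0// -expRN -mulNr//.
Qed.

(** Regularity is required entry by entry, which reduces calculus on paths to
    calculus on real functions. *)
Definition C1path (R : realType) (N : nat) (T : R) (x x' : R -> 'cV[R]_N) :=
  (forall i, {within `[0, T], continuous (fun t => x t i 0)}) /\
  (forall i t, 0 < t < T -> is_derive t (1 : R) (fun s => x s i 0) (x' t i 0)).

Lemma solves_C1path (R : realType) (N : nat) (T : R) (M : 'M[R]_N)
    (y0 : 'cV[R]_N) (y : R -> 'cV[R]_N) :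
  solves T M y0 y -> C1path T y (fun t => M *m y t).
Proof.
move=> [_ yC yD]; split=> [i t|i t tT].
  apply: (@continuous_comp (subspace `[0, T]) _ _ y (fun z : 'cV[R]_N => z i 0)).
    exact: yC.
  exact: coord_continuous.
have [yt ydt] := yD t tT; split; first by move/derivable_mxP: yt; exact.
by rewrite -ydt derive_mx// mxE.
Qed.

Lemma C1path_mulmx (R : realType) (N : nat) (T : R) (M : 'M[R]_N)
    (x x' : R -> 'cV[R]_N) :
  C1path T x x' -> C1path T (fun t => M *m x t) (fun t => M *m x' t).
Proof.
move=> [xC xD].
have E i : (fun t => (M *m x t) i 0) = \sum_j (M i j \*: (fun t => x t j 0)).
  by apply/funext => t; rewrite mxE fct_sumE.
split=> i; rewrite E.
  elim/big_ind: _ => [|f g fC gC t|j _ t].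
  - by move=> t; exact: cst_continuous.
  - exact: (@continuousD _ _ (subspace `[0, T])  f g t (fC t) (gC t)).
  - apply: (@continuousM _ (subspace `[0, T]) (fun=> M i j) (fun t => x t j 0)).
      exact: cst_continuous.
    exact: xC.
move=> t tT; rewrite mxE; apply: is_derive_sum => j.
apply: is_deriveZ; exact: xD.
Qed.

Lemma C1path_sub (R : realType) (N : nat) (T : R) (x x' y y' : R -> 'cV[R]_N) :
  C1path T x x' -> C1path T y y' ->
  C1path T (fun t => x t - y t) (fun t => x' t - y' t).
Proof.
move=> [xC xD] [yC yD].
have E i : (fun t => (x t - y t) i 0) = (fun t => x t i 0) - (fun t => y t i 0).
  by apply/funext => t; rewrite !mxE.
split=> i; rewrite E => t.
  exact: (@continuousB _ _ (subspace `[0, T]) (fun t => x t i 0)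
    (fun t => y t i 0) t (xC i t) (yC i t)).
move=> tT; rewrite !mxE; have := xD i t tT; have := yD i t tT => ? ?.
exact: is_deriveB.
Qed.

(** The Euclidean norm smoothed at the origin, so that it can be differentiated
    along a path that may vanish. *)
Definition rnorm (R : realType) (N : nat) (d : R) (x : 'cV[R]_N) : R :=
  Num.sqrt (dotp x x + d ^+ 2).

Lemma rnorm_gt0 (R : realType) (N : nat) (d : R) (x : 'cV[R]_N) :
  0 < d -> 0 < rnorm d x.
Proof. by move=> d0; rewrite sqrtr_gt0 ltr_wpDl ?dotp_ge0 ?exprn_gt0. Qed.

Lemma rnorm_sqr (R : realType) (N : nat) (d : R) (x : 'cV[R]_N) :
  rnorm d x ^+ 2 = dotp x x + d ^+ 2.
Proof. by rewrite sqr_sqrtr// addr_ge0 ?dotp_ge0 ?sqr_ge0. Qed.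

Lemma enorm_le_rnorm (R : realType) (N : nat) (d : R) (x : 'cV[R]_N) :
  enorm x <= rnorm d x.
Proof.
by rewrite ler_sqrt ?addr_ge0 ?dotp_ge0 ?sqr_ge0// lerDl sqr_ge0.
Qed.

Lemma rnorm_le (R : realType) (N : nat) (d : R) (x : 'cV[R]_N) :
  0 <= d -> rnorm d x <= enorm x + d.
Proof.
move=> d0; rewrite -ler_sqr ?nnegrE ?addr_ge0 ?enorm_ge0 ?sqrtr_ge0//.
rewrite rnorm_sqr sqrrD enorm_sqr lerD2r lerDl mulrn_wge0//.
by rewrite mulr_ge0 ?enorm_ge0.
Qed.

Lemma C1path_rnorm (R : realType) (N : nat) (T d : R) (x x' : R -> 'cV[R]_N) :
  0 < d -> C1path T x x' ->
  {within `[0, T], continuous (fun t => rnorm d (x t))} /\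
  (forall t, 0 < t < T -> is_derive t (1 : R) (fun s => rnorm d (x s))
     (dotp (x' t) (x t) / rnorm d (x t))).
Proof.
move=> d0 [xC xD].
have E : (fun t => dotp (x t) (x t)) =
    \sum_i ((fun t => x t i 0) * (fun t => x t i 0)).
  by apply/funext => t; rewrite fct_sumE.
pose q t := dotp (x t) (x t) + d ^+ 2.
have qC : {within `[0, T], continuous q}.
  have fC : {within `[0, T], continuous (fun t => dotp (x t) (x t))}.
    rewrite E; elim/big_ind: _ => [|f g fC gC t|j _ t].
    - by move=> t; exact: cst_continuous.
    - exact: (@continuousD _ _ (subspace `[0, T]) f g t (fC t) (gC t)).
    - exact: (@continuousM _ (subspace `[0, T]) (fun t => x t j 0)
        (fun t => x t j 0) t (xC j t) (xC j t)).
  move=> t; apply: (@continuousD _ _ (subspace `[0, T])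
    (fun t => dotp (x t) (x t)) (fun=> d ^+ 2)); first exact: fC.
  exact: cst_continuous.
have qD t : 0 < t < T -> is_derive t (1 : R) q (2 * dotp (x' t) (x t)).
  move=> tT; rewrite -[X in is_derive _ _ _ X]addr0.
  have -> : q = (fun t => dotp (x t) (x t)) + cst (d ^+ 2) by [].
  apply: is_deriveD; rewrite E mulr_sumr; apply: is_derive_sum => i.
  have xt := xD i t tT.
  apply: is_derive_eq; rewrite /GRing.scale/=; ring.
split=> t.
  apply: (@continuous_comp (subspace `[0, T]) _ _ q Num.sqrt).
    exact: qC.
  exact: sqrt_continuous.
move=> tT; have qt := qD t tT.
have qt0 : 0 < q t by rewrite ltr_wpDl ?dotp_ge0 ?exprn_gt0.
have st := is_derive1_sqrt qt0.
have := is_derive1_comp st qt.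
rewrite (_ : _ * _ = dotp (x' t) (x t) / rnorm d (x t))//.
rewrite -/(rnorm d (x t)); field.
by rewrite gt_eqF ?rnorm_gt0.
Qed.

(** The left-hand side is the derivative of the smoothed norm along a path with
    velocity [x'].  The error [`|k| * d] comes from [dotp x x] being
    [rnorm d x ^+ 2 - d ^+ 2], together with [d <= rnorm d x]. *)
Lemma rnorm_growth (R : realType) (N : nat) (d k b : R) (x' x : 'cV[R]_N) :
  0 < d -> 0 <= b ->
  dotp x' x <= k * dotp x x + b * enorm x ->
  dotp x' x / rnorm d x <= k * rnorm d x + (`|k| * d + b).
Proof.
move=> d0 b0 H; have r0 := rnorm_gt0 x d0.
rewrite ler_pdivrMr// (le_trans H)//.
have rE := rnorm_sqr d x; have rx := enorm_le_rnorm d x.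
have dr : d <= rnorm d x.
  rewrite -ler_sqr ?nnegrE; [|exact: ltW|exact: ltW].
  by rewrite rE lerDr dotp_ge0.
have -> : dotp x x = rnorm d x ^+ 2 - d ^+ 2 by rewrite rE addrK.
have h1 : - k * d ^+ 2 <= `|k| * d * rnorm d x.
  apply: (@le_trans _ _ (`|k| * d ^+ 2)).
    by rewrite ler_wpM2r ?sqr_ge0// -normrN ler_norm.
  by rewrite expr2 mulrA ler_wpM2l// mulr_ge0// ltW.
have h2 : b * enorm x <= b * rnorm d x by rewrite ler_wpM2l.
nra.
Qed.

Lemma le_errorP (R : realType) (c u v : R) :
  (forall d, 0 < d -> u <= v + c * d) -> u <= v.
Proof.
move=> H; apply/ler_addgt0Pr => e e0.
have c0 : 0 < `|c| + 1 by rewrite ltr_wpDl.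
apply: (le_trans (H (e / (`|c| + 1)) _)); first by rewrite divr_gt0.
rewrite lerD2l mulrA ler_pdivrMr// mulrC ler_wpM2l ?(ltW e0)//.
by rewrite (le_trans (ler_norm c))// lerDl.
Qed.

(** The rate [k] of the energy inequality for [|x|^2 / 2] is retained for [|x|]
    itself.  Absorbing the term [b |x|] into [|x|^2] by Young's inequality would
    instead spoil the exponential rate. *)
Lemma enorm_gronwall (R : realType) (N : nat) (T k b : R)
    (x x' : R -> 'cV[R]_N) : k != 0 -> 0 <= b -> C1path T x x' ->
  (forall t, 0 < t < T ->
     dotp (x' t) (x t) <= k * dotp (x t) (x t) + b * enorm (x t)) ->
  forall t, 0 <= t <= T ->
    enorm (x t) <= expR (k * t) * (enorm (x 0) + b / k) - b / k.
Proof.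
move=> k0 b0 xP energy t tT.
apply: (@le_errorP _ (expR (k * t) * (1 + `|k| / k) - `|k| / k)) => d d0.
have [rC rD] := C1path_rnorm d0 xP.
have := gronwall k0 rC rD (fun s sT => rnorm_growth d0 b0 (energy s sT)) tT.
have le0 : expR (k * t) * rnorm d (x 0) <= expR (k * t) * (enorm (x 0) + d).
  by rewrite ler_wpM2l ?expR_ge0// rnorm_le// ltW.
have := enorm_le_rnorm d (x t).
have -> : (`|k| * d + b) / k = `|k| / k * d + b / k by field.
lra.
Qed.

(** * Fast and slow components *)

Lemma symproj_enorm (R : realType) (N : nat) (Q : 'M[R]_N) (x : 'cV[R]_N) :
  Q^T = Q -> Q *m Q = Q -> enorm (Q *m x) <= enorm x.
Proof.
move=> QT QQ; rewrite ler_sqrt ?dotp_ge0//.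
have := dotp_ge0 (x - Q *m x).
have e : dotp (Q *m x) (Q *m x) = dotp (Q *m x) x.
  by rewrite dotpC dotp_mulmx QT mulmxA QQ dotpC.
rewrite dotpDl !dotpDr !dotpNl !dotpNr (dotpC x) e; lra.
Qed.

(** The abstract form of the estimates: the stiff matrix [S] is only known
    through its damping rate [a] off the range of [Pi], and only [1 / a] and
    [exp (- a t)] appear in the bounds. *)
Lemma fast_slow_bound (R : realType) (N : nat) (T a K : R) (S V Pi : 'M[R]_N)
    (y0 : 'cV[R]_N) (y z : R -> 'cV[R]_N) :
  0 < a -> 0 < K ->
  (forall u v : 'cV[R]_N, dotp (V *m u) v <= K * (enorm u * enorm v)) ->
  Pi^T = Pi -> Pi *m Pi = Pi -> S *m Pi = 0 -> Pi *m S = 0 ->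
  (forall x, Pi *m x = 0 -> dotp (S *m x) x <= - a * dotp x x) ->
  solves T (S + V) y0 y -> solves T (Pi *m V *m Pi) (Pi *m y0) z ->
  let M := expR (K * T) * enorm y0 in
  forall t, 0 <= t <= T ->
    enorm ((1%:M - Pi) *m y t) <= expR (- a * t) * enorm y0 + K * M / a /\
    enorm (Pi *m (y t - z t)) <= expR (K * T) * (K * enorm y0 + K * M) / a.
Proof.
move=> a0 K0; have aw := ltW a0; have Kw := ltW K0; move=> VK PT PP SP PS Sgap ysol zsol M t tT.
set Q := 1%:M - Pi.
have QT : Q^T = Q by rewrite /Q linearB/= trmx1 PT.
have PQ : Pi *m Q = 0 by rewrite /Q mulmxBr mulmx1 PP subrr.
have QQ : Q *m Q = Q by rewrite {1}/Q mulmxBl mul1mx PQ subr0.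
have SQ : S *m Q = S by rewrite /Q mulmxBr mulmx1 SP subr0.
have [y0E _ _] := ysol; have [z0E _ _] := zsol.
have yP := solves_C1path ysol; have zP := solves_C1path zsol.
have M0 : 0 <= M by rewrite mulr_ge0 ?expR_ge0 ?enorm_ge0.
have SE x : dotp (S *m x) (Q *m x) <= - a * dotp (Q *m x) (Q *m x).
  by rewrite -{1}SQ -mulmxA Sgap// mulmxA PQ mul0mx.
have SE0 x : dotp (S *m x) x <= 0.
  have -> : dotp (S *m x) x = dotp (S *m x) (Q *m x).
    rewrite /Q mulmxBl mul1mx dotpDr dotpNr (dotpC _ (Pi *m x)) (dotp_mulmx Pi) PT.
    by rewrite mulmxA PS mul0mx dotp0r subr0.
  by rewrite (le_trans (SE x))// mulNr oppr_le0 mulr_ge0 ?dotp_ge0.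
have yM s : 0 <= s <= T -> enorm (y s) <= M.
  move=> sT.
  have yE r : 0 < r < T -> dotp ((S + V) *m y r) (y r) <=
      K * dotp (y r) (y r) + 0 * enorm (y r).
    rewrite mul0r addr0 mulmxDl dotpDl -enorm_sqr expr2 => _.
    by rewrite (le_trans (lerD (SE0 _) (VK _ _)))// add0r.
  have K0' : K != 0 by rewrite gt_eqF.
  have := enorm_gronwall K0' (lexx 0) yP yE sT.
  rewrite !mul0r addr0 subr0 y0E => /le_trans; apply.
  rewrite ler_wpM2r ?enorm_ge0// ler_expR ler_wpM2l//.
  by case/andP: sT.
pose v s := Q *m y s; pose v' s := Q *m ((S + V) *m y s).
pose w s := Pi *m (y s - z s).
pose w' s := Pi *m ((S + V) *m y s - Pi *m V *m Pi *m z s).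
have vP : C1path T v v' by exact: C1path_mulmx.
have wP : C1path T w w' by exact/C1path_mulmx/C1path_sub.
have vE s : 0 < s < T ->
    dotp (v' s) (v s) <= - a * dotp (v s) (v s) + K * M * enorm (v s).
  move=> /andP[/ltW s0 /ltW sT].
  rewrite /v' dotp_mulmx QT {2}/v mulmxA QQ mulmxDl dotpDl lerD ?SE//.
  rewrite (le_trans (VK _ _))// -mulrA ler_wpM2l//.
  by rewrite ler_wpM2r ?enorm_ge0// yM// s0.
have wE s :
    dotp (w' s) (w s) <= K * dotp (w s) (w s) + K * enorm (v s) * enorm (w s).
  have -> : w' s = Pi *m (V *m (w s + v s)).
    rewrite /w' /w /v /Q !(mulmxDr, mulmxDl, mulmxN, mulNmx) mul1mx !mulmxA.
    rewrite PS PP mul0mx add0r.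
    by rewrite [RHS]addrC subrKA.
  rewrite dotp_mulmx PT {2}/w mulmxA PP -/(w s) mulmxDr dotpDl.
  by rewrite -enorm_sqr expr2 -mulrA lerD ?VK.
have w0 : w 0 = 0 by rewrite /w y0E z0E mulmxBr mulmxA PP subrr.
have v0 : enorm (v 0) <= enorm y0 by rewrite /v y0E symproj_enorm.
split.
  have aN0 : - a != 0 by rewrite oppr_eq0 gt_eqF.
  have KM0 : 0 <= K * M by rewrite mulr_ge0.
  apply: (le_trans (enorm_gronwall aN0 KM0 vP vE tT)).
  have e1 : 0 <= expR (- a * t) * (K * M / a).
    by rewrite mulr_ge0 ?expR_ge0 ?divr_ge0.
  have e2 : expR (- a * t) * enorm (v 0) <= expR (- a * t) * enorm y0.
    by rewrite ler_wpM2l ?expR_ge0.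
  rewrite invrN mulrN; lra.
have K0' : K != 0 by rewrite gt_eqF.
(* The coefficient of [d] collects [1 + K / a] from the initial values of the
   smoothed norms of [w] and [v], and [2] from the two uses of [rnorm_growth]. *)
apply: (@le_errorP _ (expR (K * T) * (1 + K / a + 2))) => d d0.
have [rvC rvD] := C1path_rnorm d0 vP.
have [rwC rwD] := C1path_rnorm d0 wP.
pose G s := rnorm d (w s) + K / a * rnorm d (v s).
have GC : {within `[0, T], continuous G}.
  move=> s; apply: (@continuousD _ _ (subspace `[0, T])
    (fun s => rnorm d (w s)) (fun s => K / a * rnorm d (v s))); first exact: rwC.
  apply: (@continuousM _ (subspace `[0, T]) (fun=> K / a)
    (fun s => rnorm d (v s))); first exact: cst_continuous.
  exact: rvC.
pose G' s := dotp (w' s) (w s) / rnorm d (w s) +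
  K / a * (dotp (v' s) (v s) / rnorm d (v s)).
have GD s : 0 < s < T -> is_derive s (1 : R) G (G' s).
  move=> sT; apply: is_deriveD; first exact: rwD.
  apply: is_deriveZ; exact: rvD.
have KM0 : 0 <= K * M by rewrite mulr_ge0.
have Ge s : 0 < s < T -> G' s <= K * G s + (2 * K * d + K / a * (K * M)).
  move=> sT.
  have Kv0 : 0 <= K * enorm (v s) by rewrite mulr_ge0 ?enorm_ge0.
  (* After multiplication by [K / a] the damping of [v] is [- K rnorm d (v s)],
     which absorbs the forcing [K enorm (v s)] of [w]. *)
  have h1 := rnorm_growth d0 Kv0 (wE s).
  have h2 := rnorm_growth d0 KM0 (vE s sT).
  have Ka0 : 0 <= K / a by rewrite divr_ge0.
  have := ler_wpM2l Ka0 h2.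
  rewrite normrN (gtr0_norm a0).
  have -> : K / a * (- a * rnorm d (v s) + (a * d + K * M)) =
    - K * rnorm d (v s) + (K * d + K / a * (K * M)) by field; rewrite gt_eqF.
  move: h1; rewrite (gtr0_norm K0).
  have h3 : K * enorm (v s) <= K * rnorm d (v s).
    by rewrite ler_wpM2l ?enorm_le_rnorm.
  have : 0 <= K * (K / a * rnorm d (v s)).
    by rewrite !mulr_ge0 ?sqrtr_ge0 ?invr_ge0.
  rewrite /G' /G; lra.
have Gt := gronwall K0' GC GD Ge tT.
have G0 : G 0 <= d + K / a * (enorm y0 + d).
  rewrite /G w0 lerD//.
    by rewrite (le_trans (rnorm_le _ (ltW d0)))// {1}/enorm dotp0r sqrtr0 add0r.
  rewrite ler_wpM2l ?divr_ge0//.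
  by rewrite (le_trans (rnorm_le _ (ltW d0)))// lerD2r.
have bE : (2 * K * d + K / a * (K * M)) / K = 2 * d + K * M / a.
  by field; rewrite K0' gt_eqF.
have b0 : 0 <= 2 * d + K * M / a.
  by rewrite addr_ge0 ?divr_ge0 ?(mulr_ge0 (ler0n R 2) (ltW d0)).
have eT : expR (K * t) <= expR (K * T).
  by rewrite ler_expR ler_wpM2l//; case/andP: tT.
have wG : enorm (w t) <= G t.
  rewrite (le_trans (enorm_le_rnorm d _))// lerDl.
  by rewrite mulr_ge0 ?sqrtr_ge0 ?divr_ge0.
apply: (le_trans wG); apply: (le_trans Gt); rewrite bE.
have G00 : 0 <= G 0.
  by rewrite /G addr_ge0 ?mulr_ge0 ?sqrtr_ge0 ?invr_ge0.
have : expR (K * t) * (G 0 + (2 * d + K * M / a)) <=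
    expR (K * T) * (d + K / a * (enorm y0 + d) + (2 * d + K * M / a)).
  apply: ler_pM eT _; [exact: expR_ge0|exact: addr_ge0|by rewrite lerD2r].
have -> : expR (K * T) * (d + K / a * (enorm y0 + d) + (2 * d + K * M / a)) =
   expR (K * T) * (K * enorm y0 + K * M) / a +
   expR (K * T) * (1 + K / a + 2) * d by field; rewrite gt_eqF.
lra.
Qed.

(** * The relaxation system *)

Lemma sharpD (R : realType) (N : nat) (A B : 'M[R]_N) :
  sharp (A + B) = sharp A + sharp B.
Proof.
apply/matrixP => i j; rewrite !mxE; case: eqP => _; last by [].
by rewrite -opprD -big_split/=; under eq_bigr do rewrite mxE.
Qed.

Lemma sharpZ (R : realType) (N : nat) (k : R) (A : 'M[R]_N) :
  sharp (k *: A) = k *: sharp A.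
Proof.
apply/matrixP => i j; rewrite !mxE; case: eqP => _; last by [].
by rewrite mulrN mulr_sumr; under eq_bigr do rewrite mxE.
Qed.

Lemma sharp_sym (R : realType) (N : nat) (A : 'M[R]_N) :
  A^T = A -> (sharp A)^T = sharp A.
Proof.
move=> AT; apply/matrixP => i j; rewrite !mxE eq_sym.
by case: eqP => [->//|_]; rewrite -[in RHS]AT mxE.
Qed.

Lemma cvg_sumr (R : realType) (T : Type) (F : set_system T) (FF : Filter F)
    (I : finType) (P : pred I) (f : I -> T -> R) (l : I -> R) :
  (forall i, P i -> f i x @[x --> F] --> l i) ->
  \sum_(i | P i) f i x @[x --> F] --> \sum_(i | P i) l i.
Proof. exact: (cvg_big add_continuous). Qed.

Lemma cvg_sharp (R : realType) (N : nat) (T : Type) (F : set_system T)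
    (FF : Filter F) (B : T -> 'M[R]_N) (M : 'M[R]_N) (i j : 'I_N) :
  B x @[x --> F] --> M -> sharp (B x) i j @[x --> F] --> sharp M i j.
Proof.
move=> BM.
have cB k l : B x k l @[x --> F] --> M k l.
  exact: (cvg_comp _ _ BM (@coord_continuous _ _ _ k l _)).
have -> : (fun x => sharp (B x) i j) =
    if i == j then (fun x => - \sum_(m | m != i) B x i m) else (fun x => B x j i).
  by apply/funext => x; rewrite mxE; case: eqP.
rewrite mxE; case: ifP => _; last exact: cB.
by apply: cvgN; apply: cvg_sumr => m _; exact: cB.
Qed.

Lemma orth_proj_mx (R : realType) (N : nat) (Pi : 'M[R]_N)
    (K : 'cV[R]_N -> Prop) :
  is_orth_proj Pi K -> Pi^T = Pi /\ Pi *m Pi = Pi.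
Proof.
move=> PiK.
have E x y : dotp (Pi *m x) (Pi *m y) = dotp x (Pi *m y).
  have /eqP := (PiK x).2 _ (PiK y).1.
  by rewrite dotpDl dotpNl subr_eq0 => /eqP.
have PE x y : dotp (Pi *m x) y = dotp x (Pi *m y).
  by rewrite -E dotpC -E dotpC.
have ext (A B : 'M[R]_N) : (forall x y, dotp (A *m x) y = dotp (B *m x) y) ->
    A = B.
  move=> AB; apply/eqP; rewrite -subr_eq0; apply/eqP/matrixP => i j.
  have /colP/(_ i) : (A - B) *m (delta_mx j 0 : 'cV[R]_N) = 0.
    apply: dotp_eq0; rewrite {1}mulmxBl dotpDl dotpNl AB; exact: subrr.
  by rewrite -colE !mxE.
split; apply: ext => x y; first by rewrite dotp_mulmx trmxK PE.
by rewrite -mulmxA PE E -PE.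
Qed.

(** Homogeneity extends the gap from unit vectors to the whole kernel. *)
Lemma gap_dotp (R : realType) (N : nat) (Pi S : 'M[R]_N) (r : R)
    (x : 'cV[R]_N) :
  gap_ge Pi S r -> Pi *m x = 0 -> dotp (S *m x) x <= - r * dotp x x.
Proof.
move=> gap Px; have [->|x0] := eqVneq x 0.
  by rewrite mulmx0 dotp0r mulr0.
have n0 := enorm_gt0 x0.
pose e := (enorm x)^-1 *: x.
have xe : x = enorm x *: e by rewrite scalerA divff ?gt_eqF// scale1r.
have e1 : enorm e = 1 by rewrite enormZ ?invr_ge0 ?enorm_ge0// mulVf// gt_eqF.
have Pe : Pi *m e = 0 by rewrite -scalemxAr Px scaler0.
have := gap e e1 Pe; rewrite lerNr => H.
rewrite -enorm_sqr {1 2}xe -scalemxAr dotpZl dotpZr mulrA -expr2 mulrC.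
by rewrite ler_wpM2r ?sqr_ge0.
Qed.

(** The sum of the constants of the two bounds in [fast_slow_bound], where
    [1 / a] has been replaced by [1 / r]; one constant then serves both. *)
Definition rate_const (R : realType) (N : nat) (W : 'M[R]_N) (y0 : 'cV[R]_N)
    (T r : R) : R :=
  let K := entrysum (sharp W) + 1 in
  let M := expR (K * T) * enorm y0 in
  enorm y0 + K * M / r + expR (K * T) * (K * enorm y0 + K * M) / r.

Lemma rate_const_ge0 (R : realType) (N : nat) (W : 'M[R]_N) (y0 : 'cV[R]_N)
    (T r : R) : 0 <= r -> 0 <= rate_const W y0 T r.
Proof.
move=> r0; have K0 : 0 <= entrysum (sharp W) + 1 by rewrite addr_ge0 ?entrysum_ge0.
rewrite /rate_const; move: (_ + 1) K0 => K K0.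
by rewrite !(addr_ge0, mulr_ge0, expR_ge0, invr_ge0, enorm_ge0).
Qed.

(** The rate [r] is left free, so that the one statement serves for [r = c], for
    [r = c'] and, in the limit, for [r = c / 2].  The second bound has no
    exponential term and is therefore insensitive to the rate used there. *)
Lemma relaxation_rate (R : realType) (N : nat) (W : 'M[R]_N) (y0 : 'cV[R]_N)
    (T c r nu mu eps : R) (A : 'M[R]_N) (B : R -> 'M[R]_N) (Pi : 'M[R]_N)
    (y : R -> R -> 'cV[R]_N) (z : R -> 'cV[R]_N) :
  relaxation W y0 T c nu mu A B Pi y z -> 0 < r -> 0 < eps <= 1 ->
  gap_ge Pi (sharp A + sharp (B eps)) r ->
  forall t, 0 <= t <= T ->
    enorm ((1%:M - Pi) *m y eps t) <=
      rate_const W y0 T r * (eps `^ nu + expR (- r * t * eps `^ (- nu))) /\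
    enorm (Pi *m (y eps t - z t)) <= rate_const W y0 T r * eps `^ nu.
Proof.
move=> rlx r0 e01 gap t tT; have /andP[e0 e1] := e01.
have nuP : 0 < eps `^ nu by rewrite powR_gt0.
have muP : eps `^ (- nu) <= eps `^ (- mu).
  rewrite ger_powR ?e0//lerN2; by have /andP[] := rlx_exponents rlx.
have eps01 : 0 <= eps <= 1 by rewrite ltW.
have projP := rlx_proj rlx eps01; have [PT PP] := orth_proj_mx projP.
pose S := eps `^ (- mu) *: sharp A + eps `^ (- nu) *: sharp (B eps).
have PiK x : in_ker (sharp A) (Pi *m x) /\ in_ker (sharp (B eps)) (Pi *m x).
  exact: (projP x).1.
have mxext (M : 'M[R]_N) : (forall x : 'cV[R]_N, M *m x = 0) -> M = 0.
  move=> M0; apply/matrixP => i j.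
  by have /colP/(_ i) := M0 (delta_mx j 0); rewrite -colE !mxE.
have SP : S *m Pi = 0.
  apply: mxext => x; have [Ax Bx] := PiK x.
  by rewrite -mulmxA mulmxDl -!scalemxAl Ax Bx !scaler0 addr0.
have ST : S^T = S.
  rewrite /S linearD/= !linearZ/= !sharp_sym//; first exact: rlx_symB rlx _ e01.
  exact: rlx_symA rlx.
have PS : Pi *m S = 0 by rewrite -[LHS]trmxK trmx_mul ST PT SP trmx0.
have a0 : 0 < r * eps `^ (- nu) by rewrite mulr_gt0// powR_gt0.
pose K := entrysum (sharp W) + 1.
have K0 : 0 < K by rewrite ltr_wpDl// entrysum_ge0.
have WK (u v : 'cV[R]_N) : dotp (sharp W *m u) v <= K * (enorm u * enorm v).
  rewrite (le_trans (dotp_mulmx_le _ _ _))// ler_wpM2r ?mulr_ge0 ?enorm_ge0//.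
  by rewrite lerDl.
have Sgap x : Pi *m x = 0 ->
    dotp (S *m x) x <= - (r * eps `^ (- nu)) * dotp x x.
  move=> Px; have := gap_dotp gap Px; rewrite !mulmxDl !dotpDl -!scalemxAl !dotpZl.
  have := rlx_nposA rlx x; set al := dotp _ _; set be := dotp _ _ => al0 abr.
  (* The non-positivity of [sharp A] is what makes its larger weight harmless. *)
  have h1 : eps `^ (- mu) * al <= eps `^ (- nu) * al by rewrite ler_wnM2r.
  have h2 : eps `^ (- nu) * (al + be) <= eps `^ (- nu) * (- r * dotp x x).
    by rewrite ler_wpM2l ?powR_ge0.
  lra.
have ysol : solves T (S + sharp W) y0 (y eps).
  by have := rlx_y rlx e01; rewrite /generator !sharpD !sharpZ.
have [vb wb] := fast_slow_bound a0 K0 WK PT PP SP PS Sgap ysol (rlx_z rlx) tT.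
have inva b : b / (r * eps `^ (- nu)) = b / r * eps `^ nu.
  by rewrite powRN invfM invrK mulrA.
move: vb wb; rewrite !inva => vb wb.
have Kw := ltW K0; have rw := ltW r0.
have n0 := enorm_ge0 y0; have E0 := expR_ge0 (K * T).
have M0 : 0 <= expR (K * T) * enorm y0 by rewrite mulr_ge0.
have C1 : 0 <= K * (expR (K * T) * enorm y0) / r by rewrite !mulr_ge0 ?invr_ge0.
have C2 : 0 <= expR (K * T) * (K * enorm y0 + K * (expR (K * T) * enorm y0)) / r.
  rewrite divr_ge0// mulr_ge0// addr_ge0// mulr_ge0//.
rewrite /rate_const -/K; split.
  apply: (le_trans vb); rewrite mulrDr addrC lerD//.
    by rewrite ler_wpM2r ?powR_ge0//; lra.
  have -> : - (r * eps `^ (- nu)) * t = - r * t * eps `^ (- nu) by ring.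
  by rewrite mulrC ler_wpM2r ?expR_ge0//; lra.
by apply: (le_trans wb); rewrite ler_wpM2r ?powR_ge0//; lra.
Qed.

(** The quadratic form of [B eps] is a small perturbation of that of [B 0], so
    that any rate below [c] is a spectral gap once [eps] is small. *)
Lemma relaxation_gap_near (R : realType) (N : nat) (W : 'M[R]_N)
    (y0 : 'cV[R]_N) (T c r nu mu : R) (A : 'M[R]_N) (B : R -> 'M[R]_N)
    (Pi : 'M[R]_N) (y : R -> R -> 'cV[R]_N) (z : R -> 'cV[R]_N) :
  relaxation W y0 T c nu mu A B Pi y z -> r < c ->
  \forall eps \near 0^'+, gap_ge Pi (sharp A + sharp (B eps)) r.
Proof.
move=> rlx rc.
have subE (X Y : 'M[R]_N) i j : (X - Y) i j = X i j - Y i j by rewrite !mxE.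
have D0 : entrysum (sharp (B eps) - sharp (B 0)) @[eps --> 0^'+] --> (0 : R).
  have sum0 : \sum_(i < N) \sum_(j < N) 0 = 0 :> R.
    by rewrite big1// => i _; rewrite big1.
  rewrite -[X in _ --> X]sum0.
  apply: cvg_sumr => i _; apply: cvg_sumr => j _.
  apply/norm_cvg0P.
  under eq_cvg do rewrite subE.
  have Bij : sharp (B eps) i j @[eps --> 0^'+] --> sharp (B 0) i j.
    exact: cvg_sharp (rlx_cvgB rlx).
  by have := cvgB Bij (cvg_cst (sharp (B 0) i j)); rewrite subrr; apply.
have rc0 : 0 < c - r by rewrite subr_gt0.
near=> eps => x x1 Px.
have De : `|entrysum (sharp (B eps) - sharp (B 0))| <= c - r.
  by near: eps; exact: cvgr0_norm_le.
have := dotp_mulmx_le (sharp (B eps) - sharp (B 0)) x x.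
have := (rlx_gap rlx).2 x x1 Px.
rewrite x1 !mulr1 mulmxBl !mulmxDl !dotpDl dotpNl.
have := le_trans (ler_norm _) De; lra.
Unshelve. all: by end_near. Qed.

Lemma mx_norm_le_enorm (R : realType) (N : nat) (x : 'cV[R]_N) :
  `|x| <= enorm x.
Proof.
rewrite /Num.Def.normr/= mx_normrE (bigmax_le _ (enorm_ge0 _))//= => -[i j] _.
by rewrite ord1 coord_le_enorm.
Qed.

Theorem corollary9 (R : realType) (N : nat) (W : 'M[R]_N) (y0 : 'cV[R]_N)
    (T c : R) (T_gt0 : 0 < T) (c_gt0 : 0 < c) :
  (* rate c: every eps in (0, 1] at which the minimum for B^eps is not below
     the one for B^0; C depends only on W, y0, T, c *)
  (exists C : R,
    forall (nu mu : R) (A : 'M[R]_N) (B : R -> 'M[R]_N) (Pi : 'M[R]_N)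
      (y : R -> R -> 'cV[R]_N) (z : R -> 'cV[R]_N),
    relaxation W y0 T c nu mu A B Pi y z ->
    forall eps, 0 < eps <= 1 ->
    gap_ge Pi (sharp A + sharp (B eps)) c ->
    forall t, 0 <= t <= T ->
      enorm ((1%:M - Pi) *m y eps t)
        <= C * (eps `^ nu + expR (- c * t * eps `^ (- nu))) /\
      enorm (Pi *m (y eps t - z t))
        <= C * (eps `^ nu + expR (- c * t * eps `^ (- nu))))
  /\
  (* no condition on B^eps: every rate c' < c in the first estimate, small eps;
     C depends only on W, y0, T, c, c' *)
  (forall c', 0 < c' < c -> exists C : R,
    forall (nu mu : R) (A : 'M[R]_N) (B : R -> 'M[R]_N) (Pi : 'M[R]_N)
      (y : R -> R -> 'cV[R]_N) (z : R -> 'cV[R]_N),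
    relaxation W y0 T c nu mu A B Pi y z ->
    exists eps0, 0 < eps0 <= 1 /\
      forall eps, 0 < eps <= eps0 ->
      forall t, 0 <= t <= T ->
        enorm ((1%:M - Pi) *m y eps t)
          <= C * (eps `^ nu + expR (- c' * t * eps `^ (- nu))) /\
        enorm (Pi *m (y eps t - z t))
          <= C * (eps `^ nu + expR (- c * t * eps `^ (- nu))))
  /\
  (forall (nu mu : R) (A : 'M[R]_N) (B : R -> 'M[R]_N) (Pi : 'M[R]_N)
      (y : R -> R -> 'cV[R]_N) (z : R -> 'cV[R]_N),
    relaxation W y0 T c nu mu A B Pi y z ->
    forall t, 0 < t <= T ->
      (1%:M - Pi) *m y eps t @[eps --> 0^'+] --> (0 : 'cV[R]_N)).
Proof.
have slow r s e nu t C : 0 <= C -> s <= C * e `^ nu ->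
    s <= C * (e `^ nu + expR (- r * t * e `^ (- nu))).
  by move=> C0 /le_trans; apply; rewrite ler_wpM2l// lerDl expR_ge0.
split=> [|]; last split.
- exists (rate_const W y0 T c) => nu mu A B Pi y z rlx e e01 gap t tT.
  have [vb wb] := relaxation_rate rlx c_gt0 e01 gap tT.
  by split=> //; apply: slow => //; rewrite rate_const_ge0// ltW.
- move=> c' /andP[c'0 c'c]; exists (rate_const W y0 T c').
  move=> nu mu A B Pi y z rlx.
  have [d /= d0 gapd] := relaxation_gap_near rlx c'c.
  (* [d / 2] keeps a closed interval of parameters inside the open ball. *)
  exists (Num.min 1 (d / 2)); split.
    by rewrite lt_min ltr01 divr_gt0//= ge_min lexx.
  move=> e /andP[e0]; rewrite le_min => /andP[e1 ed] t tT.
  have gap : gap_ge Pi (sharp A + sharp (B e)) c'.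
    apply: gapd => //=; rewrite sub0r normrN gtr0_norm//; lra.
  have [|vb wb] := relaxation_rate rlx c'0 _ gap tT; first by rewrite e0.
  by split=> //; apply: slow => //; rewrite rate_const_ge0// ltW.
- move=> nu mu A B Pi y z rlx t /andP[t0 tT].
  have r0 : 0 < c / 2 by rewrite divr_gt0.
  have rc : c / 2 < c by lra.
  have rt0 : 0 < c / 2 * t by rewrite mulr_gt0.
  pose C := rate_const W y0 T (c / 2).
  have nu0 : 0 < nu by have /andP[] := rlx_exponents rlx.
  apply: norm_cvg0.
  apply: (@squeeze_cvgr _ _ _ _ (fun=> 0)
    (fun e => C * (1 + (c / 2 * t)^-1) * e `^ nu)); last 2 first.
  + exact: cvg_cst.
  + rewrite -[X in _ --> X](mulr0 (C * (1 + (c / 2 * t)^-1))).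
    by apply: cvgM; [exact: cvg_cst|exact: powR_cvg0].
  near=> e; rewrite normr_ge0/= (le_trans (mx_norm_le_enorm _))//.
  have e0 : 0 < e by near: e; exact: nbhs_right_gt.
  have e01 : 0 < e <= 1 by rewrite e0/=; near: e; exact: nbhs_right_le.
  have gap : gap_ge Pi (sharp A + sharp (B e)) (c / 2).
    by near: e; exact: relaxation_gap_near rlx rc.
  have tT' : 0 <= t <= T by rewrite ltW.
  have [vb _] := relaxation_rate rlx r0 e01 gap tT'.
  apply: (le_trans vb); rewrite -[leRHS]mulrA ler_wpM2l ?rate_const_ge0 ?(ltW r0)//.
  rewrite mulrDl mul1r lerD2l powRN.
  have p0 : 0 < e `^ nu by rewrite powR_gt0.
  have x0 : 0 < c / 2 * t / e `^ nu by rewrite divr_gt0.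
  have -> : - (c / 2) * t / e `^ nu = - (c / 2 * t / e `^ nu) by rewrite !mulNr.
  have -> : (c / 2 * t)^-1 * e `^ nu = (c / 2 * t / e `^ nu)^-1.
    by rewrite [RHS]invfM invrK.
  rewrite expRN lef_pV2 ?posrE ?expR_gt0//.
  by rewrite (le_trans _ (expR_ge1Dx _))// lerDr.
Unshelve. all: by end_near. Qed.
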